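(* Let $0<\rho<\sigma<1$, $0\le\eta<1-\sigma$, and let $G_1,\dots,G_m:\mathbb{R}^n\to\mathcal{I}(\mathbb{R})$ be $gH$-continuously differentiable interval-valued maps. Let $(x^k),(d^k),(t_k),(\beta_k)$ be infinite sequences generated by the nonlinear conjugate gradient scheme described in the context, and let $L_0=\{x\in\mathbb{R}^n: G_i(x)\preceq G_i(x^0)\text{ for all }i=1,\dots,m\}$. Assume: (1) for each $i=1,\dots,m$, $\nabla_{gH}G_i$ is $gH$-Lipschitz continuous on $L_0$ with some constant $L_i$; (2) for every sequence $(y^k)$ in $L_0$ with $G_i(y^{k+1})\preceq G_i(y^k)$ for all $k$ and all $i=1,\dots,m$, there exist $\mathcal{G}_1,\dots,\mathcal{G}_m\in\mathcal{I}(\mathbb{R})$ such that $\mathcal{G}_i\preceq G_i(y^k)$ for all $k$ and all $i$. Suppose that for all $k\ge1$ $$\beta_k=\eta\,\beta_k^{CD},\qquad \beta_k^{CD}:=\frac{\psi\circ\phi_{x^k}(v(x^k))}{\psi\circ\phi_{x^{k-1}}(d^{k-1})}.$$ If $t_k$ satisfies the strong Wolfe conditions for all $k\ge0$, then $\liminf_{k\to\infty}\|v(x^k)\|=0$.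
   Context: $\|\cdot\|$ is the Euclidean norm. $\mathcal{I}(\mathbb{R})$ is the set of closed bounded intervals of $\mathbb{R}$. For $A=[a_1,a_2]$, $B=[b_1,b_2]$ in $\mathcal{I}(\mathbb{R})$ and $\alpha\in\mathbb{R}$: $A\oplus B=[a_1+b_1,a_2+b_2]$; $\alpha\odot A=A\odot\alpha=[\min\{\alpha a_1,\alpha a_2\},\max\{\alpha a_1,\alpha a_2\}]$; $A\preceq B$ means $a_1\le b_1$ and $a_2\le b_2$. Write $G_i=[\underline{G}_i,\overline{G}_i]$ with real-valued endpoint functions $\underline{G}_i\le\overline{G}_i$. ''$gH$-continuously differentiable'' means that the endpoint functions are differentiable and the $gH$-gradient $\nabla_{gH}G_i(x)$ is continuous in $x$, where $\nabla_{gH}G_i(x)$ is the vector of intervals whose $j$-th component is $[\underline{\nabla_{gH}G_i}(x)_j,\overline{\nabla_{gH}G_i}(x)_j]$ with $$\underline{\nabla_{gH}G_i}(x)_j=\min\{\partial_j\underline{G}_i(x),\partial_j\overline{G}_i(x)\},\qquad \overline{\nabla_{gH}G_i}(x)_j=\max\{\partial_j\underline{G}_i(x),\partial_j\overline{G}_i(x)\};$$ continuity means that the maps $\underline{\nabla_{gH}G_i},\overline{\nabla_{gH}G_i}:\mathbb{R}^n\to\mathbb{R}^n$ are continuous, and $gH$-Lipschitz continuity of $\nabla_{gH}G_i$ on $L_0$ with constant $L_i$ means that both of these maps are Lipschitz on $L_0$ with constant $L_i$ (Euclidean norm). For $x,v\in\mathbb{R}^n$, with $|v|=(|v_1|,\dots,|v_n|)^\top$,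 $$\psi\circ\phi_x(v):=\max_{1\le i\le m}\Big[\tfrac12\big(\underline{\nabla_{gH}G_i}(x)+\overline{\nabla_{gH}G_i}(x)\big)^\top v+\tfrac12\big(\overline{\nabla_{gH}G_i}(x)-\underline{\nabla_{gH}G_i}(x)\big)^\top|v|\Big].$$ For $x\in\mathbb{R}^n$, $v(x)$ is the unique minimizer and $\xi(x)$ the minimum value of the strongly convex function $v\mapsto\psi\circ\phi_x(v)+\tfrac12\|v\|^2$ over $\mathbb{R}^n$. Nonlinear conjugate gradient scheme: given $x^0\in\mathbb{R}^n$ and real parameters $\beta_k$ ($k\ge1$), $d^0=v(x^0)$, $d^k=v(x^k)+\beta_kd^{k-1}$ for $k\ge1$, and $x^{k+1}=x^k+t_kd^k$ with step lengths $t_k>0$. It is assumed throughout that the scheme produces infinite sequences with $\xi(x^k)\ne0$ and $v(x^k)\neq0$ for all $k$ (no stopping). Strong Wolfe conditions for $t_k$: $G_i(x^k+t_kd^k)\preceq G_i(x^k)\oplus[\rho t_k,\rho t_k]\odot\psi\circ\phi_{x^k}(d^k)$ for $i=1,\dots,m$, and $|\psi\circ\phi_{x^k+t_kd^k}(d^k)|\le\sigma\,|\psi\circ\phi_{x^k}(d^k)|$. *)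

(* Defs.v *)
From HB Require Import structures.
From mathcomp Require Import all_boot all_order all_algebra.
From mathcomp Require Import all_classical all_reals all_analysis.

Set Implicit Arguments.
Unset Strict Implicit.
Unset Printing Implicit Defensive.

Import Order.TTheory GRing.Theory Num.Theory.
Import numFieldNormedType.Exports.

Local Open Scope classical_set_scope.
Local Open Scope ring_scope.

(* Closed bounded nonempty intervals of R, given by their endpoints. *)
Record cbitv (R : realType) := CBItv {
  lo : R;
  hi : R;
  lo_le_hi : lo <= hi }.

Arguments lo {R} _.
Arguments hi {R} _.

Section IntervalArithmetic.
Context {R : realType}.
Implicit Types (A B : cbitv R) (a : R).

Definition itv_point a : cbitv R := CBItv (lexx a).

Fact itv_add_subproof A B : lo A + lo B <= hi A + hi B.
Proof. exact: lerD (lo_le_hi A) (lo_le_hi B). Qed.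

Definition itv_add A B : cbitv R := CBItv (itv_add_subproof A B).

Fact minr_le_maxr (a b : R) : Num.min a b <= Num.max a b.
Proof. by rewrite ge_min le_max lexx. Qed.

Definition itv_scale a A : cbitv R :=
  CBItv (minr_le_maxr (a * lo A) (a * hi A)).

Definition itv_le A B : Prop := lo A <= lo B /\ hi A <= hi B.

End IntervalArithmetic.

Section Euclidean.
Context {R : realType} {n : nat}.
Implicit Types u v : 'rV[R]_n.

Definition dotr u v : R := \sum_(j < n) u ord0 j * v ord0 j.

(* The library norm `|v| on row vectors is the maximum norm. *)
Definition enorm v : R := Num.sqrt (dotr v v).

Definition vabs v : 'rV[R]_n := \row_j `|v ord0 j|.

Definition elipschitz_on (D : set 'rV[R]_n) (L : R)
    (f : 'rV[R]_n -> 'rV[R]_n) : Prop :=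
  forall x y, D x -> D y -> enorm (f x - f y) <= L * enorm (x - y).

End Euclidean.

Section GHGradient.
Context {R : realType} {n : nat}.
Implicit Types (F : 'rV[R]_n -> cbitv R) (x : 'rV[R]_n).

Definition partial (f : 'rV[R]_n -> R) (j : 'I_n) x : R :=
  'D_(delta_mx ord0 j) f x.

Definition gH_grad F x (j : 'I_n) : cbitv R :=
  CBItv (minr_le_maxr (partial (lo \o F) j x) (partial (hi \o F) j x)).

Definition gH_grad_lo F x : 'rV[R]_n := \row_j lo (gH_grad F x j).

Definition gH_grad_hi F x : 'rV[R]_n := \row_j hi (gH_grad F x j).

Definition gH_cont_differentiable F : Prop :=
  [/\ forall x, differentiable (lo \o F) x,
      forall x, differentiable (hi \o F) x,
      continuous (gH_grad_lo F) &
      continuous (gH_grad_hi F)].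

Definition gH_grad_lipschitz_on (D : set 'rV[R]_n) (L : R) F : Prop :=
  elipschitz_on D L (gH_grad_lo F) /\ elipschitz_on D L (gH_grad_hi F).

End GHGradient.

(* The interval-valued objectives are indexed by 'I_m.+1, so there is at least
   one of them. *)
Section ConjugateGradient.
Context {R : realType} {n m : nat} (G : 'I_m.+1 -> 'rV[R]_n -> cbitv R).
Implicit Types (x v : 'rV[R]_n).

Definition psi_phi_comp x v (i : 'I_m.+1) : R :=
  2^-1 * dotr (gH_grad_lo (G i) x + gH_grad_hi (G i) x) v
  + 2^-1 * dotr (gH_grad_hi (G i) x - gH_grad_lo (G i) x) (vabs v).

(* Starting the iterated maximum at the component of index 0 makes it the
   maximum of the components, whatever their signs. *)
Definition psi_phi x v : R :=
  \big[Num.max/psi_phi_comp x v ord0]_(i < m.+1) psi_phi_comp x v i.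

Definition dir_objective x v : R := psi_phi x v + 2^-1 * enorm v ^+ 2.

(* dir_objective x is continuous and strongly convex, so that its minimizer
   exists and is unique: [get] selects that minimizer. *)
Definition vdir x : 'rV[R]_n :=
  get [set v | forall w, dir_objective x v <= dir_objective x w].

Definition xi x : R := dir_objective x (vdir x).

(* The step lengths are positive and the scheme never stops. *)
Definition ncg_scheme (beta t : nat -> R) (x d : nat -> 'rV[R]_n) : Prop :=
  [/\ d 0%N = vdir (x 0%N),
      forall k, d k.+1 = vdir (x k.+1) + beta k.+1 *: d k,
      forall k, x k.+1 = x k + t k *: d k,
      forall k, 0 < t k &
      forall k, xi (x k) != 0 /\ vdir (x k) != 0].

Definition strong_wolfe (rho sigma t : R) x d : Prop :=
  (forall i, itv_le (G i (x + t *: d))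
               (itv_add (G i x)
                  (itv_scale (psi_phi x d) (itv_point (rho * t))))) /\
  `|psi_phi (x + t *: d) d| <= sigma * `|psi_phi x d|.

Definition level_set (x0 : 'rV[R]_n) : set 'rV[R]_n :=
  [set x | forall i, itv_le (G i x) (G i x0)].

Definition betaCD (x d : nat -> 'rV[R]_n) (k : nat) : R :=
  psi_phi (x k) (vdir (x k)) / psi_phi (x k.-1) (d k.-1).

End ConjugateGradient.

(* Main.v *)
Require Import Defs.
From HB Require Import structures.
From mathcomp Require Import all_boot all_order all_algebra.
From mathcomp Require Import all_classical all_reals all_analysis.
From mathcomp Require Import ring lra.

Set Implicit Arguments.
Unset Strict Implicit.
Unset Printing Implicit Defensive.

Import Order.TTheory GRing.Theory Num.Theory.
Import numFieldNormedType.Exports.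

Local Open Scope classical_set_scope.
Local Open Scope ring_scope.

(** Write [f_x] for [psi_phi G x], [v_k] for [vdir G (x k)], [P_k] for
[f_(x_k) (d_k)] and [c = 1 - sigma * eta].  The function [f_x] is a maximum of
support functions of boxes, hence sublinear.  Optimality of [v_k] along the
ray that it spans gives [f_(x_k) (v_k) = - |v_k|^2] ([psi_phi_vdir]), and three
facts follow.

Sufficient descent, [P_k <= - c |v_k|^2]: by sublinearity
[P_k <= f_(x_k) (v_k) + beta_k f_(x_k) (d_(k-1))], the curvature condition
bounds [f_(x_k) (d_(k-1))] by [- sigma P_(k-1)], and the choice of [beta_k] turns
the last product into [sigma eta |v_k|^2] ([cd_descent_step]).

Steps are not too short: the curvature condition forces [f] to change by at
least [(1 - sigma) |P_k|] in the direction [d_k] between [x_k] and [x_(k+1)], while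
Lipschitz gradients allow a change of at most [2 L t_k |d_k|^2]
([wolfe_step_bound]).

Directions are not too long: descent gives
[beta_k <= (eta / c) |v_k|^2 / |v_(k-1)|^2], so the ratios
[r_k = |d_k| / |v_k|^2] satisfy [r_k <= 1 / |v_k| + (eta / c) r_(k-1)].  The
condition [eta < 1 - sigma] makes [eta / c < 1], hence [r_k] stays bounded as long
as [|v_k|] stays away from zero.

If [|v_k|] were eventually bounded away from zero, then [t_k |P_k|] would be
bounded below by a constant multiple of [P_k^2 / |d_k|^2 >= c^2 / r_k^2], that is,
by a positive constant.  The Armijo condition would then make the objectives
decrease by a fixed amount at each step, against their boundedness below
([cd_gradient_not_bounded_away]). *)

(** * Euclidean geometry of row vectors *)

Section EuclideanSpace.
Context {R : realType} {n : nat}.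
Implicit Types (u v w : 'rV[R]_n) (a : R).

Lemma dotrC u v : dotr u v = dotr v u.
Proof. by apply: eq_bigr => j _; rewrite mulrC. Qed.

Lemma dotrDl u v w : dotr (u + v) w = dotr u w + dotr v w.
Proof. by rewrite -big_split; apply: eq_bigr => j _; rewrite mxE mulrDl. Qed.

Lemma dotrZl a u v : dotr (a *: u) v = a * dotr u v.
Proof. by rewrite mulr_sumr; apply: eq_bigr => j _; rewrite mxE mulrA. Qed.

Lemma dotrDr u v w : dotr w (u + v) = dotr w u + dotr w v.
Proof. by rewrite dotrC dotrDl !(dotrC w). Qed.

Lemma dotrZr a u v : dotr u (a *: v) = a * dotr u v.
Proof. by rewrite dotrC dotrZl dotrC. Qed.

Lemma dotrNl u v : dotr (- u) v = - dotr u v.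
Proof. by rewrite -scaleN1r dotrZl mulN1r. Qed.

Lemma dotrr_ge0 u : 0 <= dotr u u.
Proof. by apply: sumr_ge0 => j _; rewrite -expr2 sqr_ge0. Qed.

Lemma dotrr_eq0 u : (dotr u u == 0) = (u == 0).
Proof.
apply/idP/eqP => [|->]; last by rewrite /dotr big1 // => j _; rewrite mxE mul0r.
rewrite psumr_eq0 => [/allP u0|j _]; last by rewrite -expr2 sqr_ge0.
apply/rowP => j; rewrite mxE; have := u0 j (mem_index_enum _).
by rewrite -expr2 sqrf_eq0 => /eqP.
Qed.

Lemma enorm_ge0 u : 0 <= enorm u.
Proof. exact: sqrtr_ge0. Qed.

Lemma enorm_sqr u : enorm u ^+ 2 = dotr u u.
Proof. exact/sqr_sqrtr/dotrr_ge0. Qed.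

Lemma enorm_eq0 u : (enorm u == 0) = (u == 0).
Proof. by rewrite -dotrr_eq0 -enorm_sqr sqrf_eq0. Qed.

Lemma enorm_gt0 u : (0 < enorm u) = (u != 0).
Proof. by rewrite lt0r enorm_ge0 andbT enorm_eq0. Qed.

Lemma enormZ a u : enorm (a *: u) = `|a| * enorm u.
Proof.
by rewrite /enorm dotrZl dotrZr mulrA -expr2 sqrtrM ?sqr_ge0// sqrtr_sqr.
Qed.

Lemma enormN u : enorm (- u) = enorm u.
Proof. by rewrite -scaleN1r enormZ normrN1 mul1r. Qed.

Lemma enorm_vabs u : enorm (vabs u) = enorm u.
Proof.
congr Num.sqrt; apply: eq_bigr => j _.
by rewrite mxE -normrM ger0_norm // -expr2 sqr_ge0.
Qed.

Lemma vabsZ a u : 0 <= a -> vabs (a *: u) = a *: vabs u.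
Proof. by move=> a0; apply/rowP => j; rewrite !mxE normrM ger0_norm. Qed.

Lemma cauchy_schwarz u v : dotr u v <= enorm u * enorm v.
Proof.
have [->|u0] := eqVneq u 0.
  rewrite /dotr big1 => [|j _]; last by rewrite mxE mul0r.
  by rewrite mulr_ge0 ?enorm_ge0.
have [->|v0] := eqVneq v 0.
  rewrite /dotr big1 => [|j _]; last by rewrite mxE mulr0.
  by rewrite mulr_ge0 ?enorm_ge0.
have uv0 : 0 < enorm u * enorm v by rewrite mulr_gt0 ?enorm_gt0.
have := dotrr_ge0 (enorm v *: u + (- enorm u) *: v).
rewrite !dotrDl !dotrDr !dotrZl !dotrZr (dotrC v u) -!enorm_sqr => h.
rewrite -(ler_pM2l uv0); nra.
Qed.

Lemma enormD u v : enorm (u + v) <= enorm u + enorm v.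
Proof.
rewrite -(@ler_pXn2r _ 2) ?nnegrE ?addr_ge0 ?enorm_ge0//.
rewrite enorm_sqr !dotrDl !dotrDr (dotrC v u) -!enorm_sqr.
have := cauchy_schwarz u v; nra.
Qed.

Lemma ler_dotr u v w :
  (forall j, 0 <= u ord0 j) -> (forall j, v ord0 j <= w ord0 j) ->
  dotr u v <= dotr u w.
Proof. by move=> u0 vw; apply: ler_sum => j _; rewrite ler_wpM2l. Qed.

(** For [a <= b] componentwise, the sum of the first two terms on the right is
the support function at [v] of the box [[a, b]].  Passing from [a, b] to
[a', b'] changes it by four inner products with [v] or [vabs v], each of weight
one half and each bounded by [K * enorm v]; hence the factor [2]. *)
Lemma support_function_lipschitz (a b a' b' v : 'rV[R]_n) (K : R) :
  enorm (a' - a) <= K -> enorm (b' - b) <= K ->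
  2^-1 * dotr (a' + b') v + 2^-1 * dotr (b' - a') (vabs v) <=
  2^-1 * dotr (a + b) v + 2^-1 * dotr (b - a) (vabs v) + 2 * K * enorm v.
Proof.
move=> aK bK.
have cs (u z : 'rV[R]_n) :
    enorm u <= K -> enorm z = enorm v -> dotr u z <= K * enorm v.
  move=> uK <-; apply: le_trans (cauchy_schwarz _ _) _.
  by rewrite ler_wpM2r ?enorm_ge0.
have h1 := cs _ _ aK (erefl _).
have h2 := cs _ _ bK (erefl _).
have h3 := cs _ _ bK (enorm_vabs v).
have h4 : - dotr (a' - a) (vabs v) <= K * enorm v.
  by rewrite -dotrNl; apply: cs; rewrite ?enormN ?enorm_vabs.
move: h1 h2 h3 h4; clear.
rewrite !dotrDl !dotrNl -(mulrA 2); move: (K * _) => ?.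
do 2!move: (dotr a _) (dotr b _) (dotr a' _) (dotr b' _) => ? ? ? ?.
lra.
Qed.

End EuclideanSpace.

(** * The maximal directional derivative and the steepest descent direction *)

Section MaxDirectionalDerivative.
Context {R : realType} {n m : nat} (G : 'I_m.+1 -> 'rV[R]_n -> cbitv R).
Implicit Types (x y v w : 'rV[R]_n).

Lemma psi_phi_le x v (c : R) :
  (forall i, psi_phi_comp G x v i <= c) -> psi_phi G x v <= c.
Proof. by move=> h; apply: bigmax_le => [|i _]; exact: h. Qed.

Lemma psi_phi_comp_le x v i : psi_phi_comp G x v i <= psi_phi G x v.
Proof. exact: le_bigmax. Qed.

Lemma psi_phiZ x v (a : R) : 0 <= a -> psi_phi G x (a *: v) <= a * psi_phi G x v.
Proof.
move=> a0; apply: psi_phi_le => i.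
have -> : psi_phi_comp G x (a *: v) i = a * psi_phi_comp G x v i.
  by rewrite /psi_phi_comp (vabsZ v a0) !dotrZr; ring.
by rewrite ler_wpM2l ?psi_phi_comp_le.
Qed.

(** The coefficients of [vabs] in each component are nonnegative, being widths
of the gradient intervals; this is what makes the components subadditive. *)
Lemma psi_phiD x v w : psi_phi G x (v + w) <= psi_phi G x v + psi_phi G x w.
Proof.
apply: psi_phi_le => i.
apply: le_trans (lerD (psi_phi_comp_le x v i) (psi_phi_comp_le x w i)).
have h : dotr (gH_grad_hi (G i) x - gH_grad_lo (G i) x) (vabs (v + w)) <=
         dotr (gH_grad_hi (G i) x - gH_grad_lo (G i) x) (vabs v + vabs w).
  apply: ler_dotr => j; rewrite !mxE ?ler_normD// subr_ge0.
  exact: lo_le_hi (gH_grad (G i) x j).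
rewrite dotrDr in h; rewrite /psi_phi_comp dotrDr; lra.
Qed.

Lemma psi_phi_lipschitz (D : set 'rV[R]_n) (L : R) x y v :
  (forall i, gH_grad_lipschitz_on D L (G i)) -> D x -> D y ->
  psi_phi G y v <= psi_phi G x v + 2 * L * enorm (y - x) * enorm v.
Proof.
move=> GL Dx Dy; apply: psi_phi_le => i.
apply: le_trans (lerD (psi_phi_comp_le x v i) (lexx _)).
have [/(_ _ _ Dy Dx) llo /(_ _ _ Dy Dx) lhi] := GL i.
by rewrite -(mulrA 2); exact: support_function_lipschitz.
Qed.

(** The default value of [get] on an empty set of row vectors is [0], so a
nonzero [vdir] certifies that the minimizer exists. *)
Lemma vdir_min x w :
  vdir G x != 0 -> dir_objective G x (vdir G x) <= dir_objective G x w.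
Proof.
move=> v0.
have [ex|nex] := pselect (exists v, forall w,
    dir_objective G x v <= dir_objective G x w).
  exact: (getPex ex).
suff vE : vdir G x = 0 by rewrite vE eqxx in v0.
rewrite /vdir getPN => [|v hv]; last by apply: nex; exists v.
by apply/rowP => j; rewrite !mxE.
Qed.

(** Along the ray through the minimizer the objective is at most
[c * p + c ^+ 2 * N / 2], whose minimum over [c >= 0] must be attained at
[c = 1]. *)
Lemma psi_phi_vdir x :
  vdir G x != 0 -> psi_phi G x (vdir G x) = - enorm (vdir G x) ^+ 2.
Proof.
move=> v0; set v := vdir G x; set p := psi_phi G x v; set N := enorm v ^+ 2.
have N0 : 0 < N by rewrite exprn_gt0 ?enorm_gt0.
have ray c : 0 <= c -> p + 2^-1 * N <= c * p + 2^-1 * (c ^+ 2 * N).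
  move=> c0; apply: le_trans (vdir_min (c *: v) v0) _.
  rewrite /dir_objective enormZ ger0_norm// exprMn -/N lerD2r.
  exact: psi_phiZ.
have p0 : p <= 0 by have := ray 0 (lexx _); lra.
(* [- p / N] minimizes the quadratic along the ray; comparing its value with
   the one at [1] gives [(p + N) ^+ 2 <= 0]. *)
have c0 : 0 <= - p / N by apply: divr_ge0; [rewrite oppr_ge0 | exact: ltW].
have := ray _ c0.
have -> : - p / N * p + 2^-1 * ((- p / N) ^+ 2 * N) = - (2^-1 * (p ^+ 2 / N)).
  by field; rewrite gt_eqF.
move=> h; apply/eqP; rewrite -subr_eq0 opprK -sqrf_eq0 eq_le sqr_ge0 andbT.
have e : p ^+ 2 / N * N = p ^+ 2 by rewrite divfK // gt_eqF.
have := ler_wpM2r (ltW N0) h; nra.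
Qed.

End MaxDirectionalDerivative.

(** * One step under the strong Wolfe conditions *)

Lemma curvature_gap (R : realDomainType) (s p q : R) :
  p <= 0 -> `|q| <= s * `|p| -> (1 - s) * - p <= q - p.
Proof.
by move=> p0; rewrite (ler0_norm p0) ler_norml => /andP[h _]; lra.
Qed.

Section WolfeStep.
Context {R : realType} {n m : nat} (G : 'I_m.+1 -> 'rV[R]_n -> cbitv R).
Context (rho sigma t : R) (x d : 'rV[R]_n).
Context (wolfe : strong_wolfe G rho sigma t x d).

Lemma wolfe_decrease i :
  lo (G i (x + t *: d)) <= lo (G i x) + rho * t * psi_phi G x d /\
  hi (G i (x + t *: d)) <= hi (G i x) + rho * t * psi_phi G x d.
Proof.
by have [/(_ i)[/= hl hh] _] := wolfe; move: hl hh; rewrite minxx maxxx mulrC.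
Qed.

(** The step cannot be too short: the curvature condition asks the directional
derivative along [d] to rise by a fixed fraction of its size, and Lipschitz
continuity allows no faster rise than in proportion to the displacement
[t * enorm d]. *)
Lemma wolfe_step_bound (D : set 'rV[R]_n) (L : R) :
  (forall i, gH_grad_lipschitz_on D L (G i)) -> D x -> D (x + t *: d) ->
  0 <= t -> psi_phi G x d <= 0 ->
  (1 - sigma) * - psi_phi G x d <= 2 * L * (t * enorm d ^+ 2).
Proof.
move=> GL Dx Dy t0 p0; have [_ curv] := wolfe.
apply: le_trans (curvature_gap p0 curv) _; rewrite lerBlDl.
have -> : 2 * L * (t * enorm d ^+ 2) =
    2 * L * enorm (x + t *: d - x) * enorm d.
  by rewrite (addrC x) addrK enormZ (ger0_norm t0); ring.
exact: psi_phi_lipschitz.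
Qed.

End WolfeStep.

(** * Real sequences *)

(** The recursion is a contraction with fixed point [a / (1 - delta)], and no
term overshoots the larger of this point and the initial value. *)
Lemma affine_recursion_bounded (R : realFieldType) (a delta : R) (r : nat -> R) :
  0 <= delta -> delta < 1 -> (forall k, r k.+1 <= a + delta * r k) ->
  exists M, forall k, r k <= M.
Proof.
move=> d0 d1 rec; exists (Num.max (r 0%N) (a / (1 - delta))).
set M := Num.max _ _.
have aM : a <= M * (1 - delta) by rewrite -ler_pdivrMr ?subr_gt0// le_max lexx orbT.
elim=> [|k IH]; first by rewrite le_max lexx.
apply: le_trans (rec k) _.
have := ler_wpM2l d0 IH; lra.
Qed.

Lemma bounded_below_no_uniform_decrease (R : realType) (b e : R) (u : nat -> R) :
  0 < e -> (forall k, b <= u k) -> ~ (forall k, u k.+1 <= u k - e).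
Proof.
move=> e0 ub dec.
have lin k : u k <= u 0%N - k%:R * e.
  elim: k => [|k IH]; first by rewrite mul0r subr0.
  by rewrite -natr1; have := dec k; lra.
pose N := Num.bound ((u 0%N - b) / e).
have : (u 0%N - b) / e < N%:R.
  by apply: archi_boundP; rewrite divr_ge0 ?subr_ge0 ?ub// ltW.
rewrite ltr_pdivrMr // => h; have := le_trans (ub N) (lin N); lra.
Qed.

Lemma limn_einf_eq0 (R : realType) (u : nat -> R) :
  (forall k, 0 <= u k) ->
  (forall e, 0 < e -> forall N, exists2 k, (N <= k)%N & u k < e) ->
  limn_einf (fun k => (u k)%:E) = 0%E.
Proof.
move=> u0 small; rewrite limn_einf_lim.
suff -> : einfs (fun k => (u k)%:E) = cst 0%E by rewrite lim_cst.
apply/funext => N; rewrite /einfs /=; apply/eqP; rewrite eq_le; apply/andP; split.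
  apply/lee_addgt0Pr => e e0; rewrite add0e.
  have [k Nk /ltW uk] := small e e0 N.
  by apply: le_trans (_ : (u k)%:E <= _)%E;
    [apply: ereal_inf_lbound; exists k | rewrite lee_fin].
by apply: le_ereal_inf_tmp => _ [k _ <-]; rewrite lee_fin.
Qed.

(** * Descent and step lengths of the conjugate descent method *)

(** The inductive step of sufficient descent, with [V2] the squared norm of the
steepest descent direction at the new point, [P] the previous directional
derivative, and [q] the derivative along the previous direction at the new
point.  The conjugate descent parameter [eta * (V2 / - P)] cancels [P] in the
curvature bound on [q], leaving [s * eta * V2]. *)
Lemma cd_descent_step (R : realFieldType) (s eta V2 P q P' : R) :
  0 <= eta -> 0 <= V2 -> P < 0 -> q <= s * `|P| ->
  P' <= - V2 + eta * (V2 / - P) * q -> P' <= - ((1 - s * eta) * V2).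
Proof.
move=> eta0 V0 P0; rewrite (ltr0_norm P0) => qP /le_trans; apply.
have b0 : 0 <= eta * (V2 / - P).
  by rewrite mulr_ge0 // divr_ge0 // oppr_ge0 ltW.
have := ler_wpM2l b0 qP.
rewrite (_ : _ * (s * - P) = s * eta * V2); last by field; rewrite lt_eqF.
lra.
Qed.

(** The contradiction behind the convergence theorem, in terms of the sequences
[V] of steepest descent norms, [P] of directional derivatives, [D] of direction
norms, [t] of step lengths and [f] of values of one endpoint function.  If [V]
stays above [gam], the ratios [D / V ^+ 2] are bounded, so the step bound makes
[t * - P] exceed a positive constant and [f] has no lower bound [b]. *)
Lemma cd_gradient_not_bounded_away (R : realType)
    (rho sigma eta K b gam : R) (V P D t f : nat -> R) :
  0 < rho -> 0 < sigma -> sigma < 1 -> 0 <= eta -> eta < 1 - sigma ->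
  0 < K -> 0 < gam ->
  (forall k, gam <= V k) -> (forall k, 0 <= D k) -> (forall k, 0 < t k) ->
  (forall k, P k <= - ((1 - sigma * eta) * V k ^+ 2)) ->
  (forall k, D k.+1 <= V k.+1 + eta * (V k.+1 ^+ 2 / - P k) * D k) ->
  (forall k, (1 - sigma) * - P k <= K * (t k * D k ^+ 2)) ->
  (forall k, f k.+1 <= f k + rho * (t k * P k)) ->
  ~ (forall k, b <= f k).
Proof.
move=> rho0 sigma0 sigma1 eta0 eta1 K0 gam0 V_ge D_ge0 t_gt0.
set c := 1 - sigma * eta => descent D_rec step dec fb.
have c_gt0 : 0 < c by rewrite /c; nra.
have V_gt0 k : 0 < V k by exact: lt_le_trans (V_ge k).
have W_gt0 k : 0 < V k ^+ 2 by rewrite exprn_gt0.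
have cW_gt0 k : 0 < c * V k ^+ 2 by rewrite mulr_gt0.
have cWP k : c * V k ^+ 2 <= - P k by rewrite lerNr descent.
have NP_gt0 k : 0 < - P k by exact: lt_le_trans (cWP k).
pose delta := eta / c.
pose r k := D k / V k ^+ 2.
have delta_ge0 : 0 <= delta by rewrite divr_ge0 // ltW.
(* [eta < 1 - sigma * eta] because
   [eta * (1 + sigma) < (1 - sigma) * (1 + sigma) < 1]. *)
have delta_lt1 : delta < 1 by rewrite ltr_pdivrMr // mul1r /c; nra.
have r_rec k : r k.+1 <= gam^-1 + delta * r k.
  rewrite /r ler_pdivrMr //; apply: le_trans (D_rec k) _; rewrite mulrDl lerD //.
    rewrite expr2 mulrA ler_peMl ?(ltW (V_gt0 _)) // mulrC ler_pdivlMr //.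
    by rewrite mul1r.
  rewrite (_ : _ * V k.+1 ^+ 2 =
     eta * (V k.+1 ^+ 2 / (c * V k ^+ 2)) * D k); last first.
    by rewrite /delta; field; rewrite !gt_eqF.
  by rewrite ler_wpM2r // ler_wpM2l // ler_wpM2l ?(ltW (W_gt0 _)) // lef_pV2 ?posrE.
have [M0 rM0] := affine_recursion_bounded delta_ge0 delta_lt1 r_rec.
(* The maximum with [1] makes the bound positive, so that it can be divided by. *)
pose M := Num.max M0 1.
have M_gt0 : 0 < M by rewrite lt_max ltr01 orbT.
have D_le k : D k <= M * V k ^+ 2.
  by rewrite -ler_pdivrMr // le_max; apply/orP; left; exact: rM0.
pose e := (1 - sigma) * c ^+ 2 / (K * M ^+ 2).
have KM_gt0 : 0 < K * M ^+ 2 by rewrite mulr_gt0 // exprn_gt0.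
have e_gt0 : 0 < e by rewrite divr_gt0 // mulr_gt0 ?subr_gt0 // exprn_gt0.
(* Multiplied by [- P], the step bound reads
   [(1 - sigma) * P ^+ 2 <= K * (t * - P) * D ^+ 2]; the powers of [V] in the
   bounds on [P] and [D] then cancel. *)
have e_le k : e <= t k * - P k.
  move: (D_le k) (cWP k) (step k) (t_gt0 k) (NP_gt0 k) (W_gt0 k) (D_ge0 k).
  move: (V k ^+ 2) (- P k) (D k) (t k) => W p Dk tk DM cWp st tk0 p0 W0 D0.
  rewrite ler_pdivrMr // -(ler_pM2r (exprn_gt0 2 W0)).
  have D2 : Dk ^+ 2 <= (M * W) ^+ 2.
    by rewrite ler_pXn2r // nnegrE mulr_ge0 // ltW.
  have p2 : (c * W) ^+ 2 <= p ^+ 2.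
    by rewrite ler_pXn2r // nnegrE ?mulr_ge0 // ltW.
  have s0 : 0 <= 1 - sigma by rewrite subr_ge0 ltW.
  have h1 := ler_wpM2l s0 p2.
  have h2 := ler_wpM2r (ltW p0) st.
  have Ktp : 0 <= K * (tk * p) by rewrite !mulr_ge0 // ltW.
  have h3 := ler_wpM2l Ktp D2.
  move: h1 h2 h3; clear; lra.
apply: (@bounded_below_no_uniform_decrease _ b (rho * e) f) => // [|k].
  by rewrite mulr_gt0.
have := ler_wpM2l (ltW rho0) (e_le k); have := dec k; lra.
Qed.

Theorem theorem4p3 (R : realType) (n m : nat) (rho sigma eta : R)
    (G : 'I_m.+1 -> 'rV[R]_n -> cbitv R)
    (beta t : nat -> R) (x d : nat -> 'rV[R]_n)
    (rho_gt0 : 0 < rho) (rho_lt_sigma : rho < sigma) (sigma_lt1 : sigma < 1)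
    (eta_ge0 : 0 <= eta) (eta_lt : eta < 1 - sigma)
    (G_smooth : forall i, gH_cont_differentiable (G i))
    (scheme : ncg_scheme G beta t x d)
    (G_lipschitz : forall i, exists L : R,
       gH_grad_lipschitz_on (level_set G (x 0%N)) L (G i))
    (G_bounded : forall y : nat -> 'rV[R]_n,
       (forall k, level_set G (x 0%N) (y k)) ->
       (forall k i, itv_le (G i (y k.+1)) (G i (y k))) ->
       exists B : 'I_m.+1 -> cbitv R,
         forall k i, itv_le (B i) (G i (y k)))
    (beta_CD : forall k, (1 <= k)%N -> beta k = eta * betaCD G x d k)
    (wolfe : forall k, strong_wolfe G rho sigma (t k) (x k) (d k)) :
  limn_einf (fun k => (enorm (vdir G (x k)))%:E) = 0%E.
Proof.
have [d0E dE xE t_gt0 nostop] := scheme.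
have sigma_gt0 := lt_trans rho_gt0 rho_lt_sigma.
pose V k := enorm (vdir G (x k)).
pose P k := psi_phi G (x k) (d k).
have c_gt0 : 0 < 1 - sigma * eta by nra.
have V2_gt0 k : 0 < V k ^+ 2.
  by rewrite exprn_gt0 // enorm_gt0; case: (nostop k).
have psi_v k : psi_phi G (x k) (vdir G (x k)) = - V k ^+ 2.
  by apply: psi_phi_vdir; case: (nostop k).
have betaE k : beta k.+1 = eta * (V k.+1 ^+ 2 / - P k).
  by rewrite beta_CD // /betaCD psi_v invrN mulrN mulNr.
have beta_ge0 k : P k < 0 -> 0 <= beta k.+1.
  move=> P0; rewrite betaE mulr_ge0 // divr_ge0 ?(ltW (V2_gt0 _)) //.
  by rewrite oppr_ge0 ltW.
have descent_lt0 k : P k <= - ((1 - sigma * eta) * V k ^+ 2) -> P k < 0.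
  by move=> /le_lt_trans; apply; rewrite oppr_lt0 mulr_gt0.
have descent k : P k <= - ((1 - sigma * eta) * V k ^+ 2).
  elim: k => [|k /descent_lt0 Pk].
    rewrite /P d0E psi_v lerN2 ler_piMl ?(ltW (V2_gt0 _)) //.
    by rewrite gerBl mulr_ge0 // ltW.
  have curv : psi_phi G (x k.+1) (d k) <= sigma * `|P k|.
    by rewrite xE; have [_] := wolfe k; exact: le_trans (ler_norm _).
  apply: (cd_descent_step eta_ge0 (ltW (V2_gt0 _)) Pk curv).
  rewrite -betaE -psi_v {1}/P dE; apply: le_trans (psi_phiD _ _ _ _) _.
  by rewrite lerD2l; exact: psi_phiZ (beta_ge0 _ Pk).
have P_lt0 k : P k < 0 by exact: descent_lt0 (descent k).
have decr k i :
    lo (G i (x k.+1)) <= lo (G i (x k)) + rho * (t k * P k) /\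
    hi (G i (x k.+1)) <= hi (G i (x k)) + rho * (t k * P k).
  by rewrite xE mulrA; exact: wolfe_decrease (wolfe k) i.
have tP_le0 k : rho * (t k * P k) <= 0 by rewrite ltW // !pmulr_rlt0.
have mono k i : itv_le (G i (x k.+1)) (G i (x k)).
  by have [hl hh] := decr k i; split;
    [apply: le_trans hl _ | apply: le_trans hh _]; rewrite gerDl.
have level k : level_set G (x 0%N) (x k).
  elim: k => [|k IH] i; first by split.
  have [l1 h1] := mono k i; have [l2 h2] := IH i.
  by split; [exact: le_trans l2 | exact: le_trans h2].
have [B HB] := G_bounded x level mono.
have [L [L_gt0 GL]] : exists L, 0 < L /\
    forall i, gH_grad_lipschitz_on (level_set G (x 0%N)) L (G i).
  (* The constants may be nonpositive; including [1] in their maximum makes the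
     common constant positive. *)
  have [Li GLi] := choice G_lipschitz.
  exists (\big[Num.max/1]_i Li i); split.
    by apply: lt_le_trans (bigmax_ge_id _ _ _ _); exact: ltr01.
  move=> i; have LiL := le_bigmax 1 Li i; have [h1 h2] := GLi i.
  by split=> y z Dy Dz;
    [apply: le_trans (h1 y z Dy Dz) _ | apply: le_trans (h2 y z Dy Dz) _];
    rewrite ler_wpM2r ?enorm_ge0.
have step k : (1 - sigma) * - P k <= 2 * L * (t k * enorm (d k) ^+ 2).
  have level1 := level k.+1; rewrite xE in level1.
  exact: (wolfe_step_bound (wolfe k) GL (level k) level1
            (ltW (t_gt0 k)) (ltW (P_lt0 k))).
apply: limn_einf_eq0 => [k|gam gam_gt0 N]; first exact: enorm_ge0.
apply: contrapT => none.
have V_ge k : gam <= V (N + k)%N.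
  rewrite leNgt; apply/negP => h; apply: none.
  by exists (N + k)%N; rewrite ?leq_addr.
have D_rec k : enorm (d (N + k.+1)%N) <= V (N + k.+1)%N +
    eta * (V (N + k.+1)%N ^+ 2 / - P (N + k)%N) * enorm (d (N + k)%N).
  rewrite addnS -betaE dE; apply: le_trans (enormD _ _) _.
  by rewrite lerD2l enormZ ger0_norm ?beta_ge0.
have f_dec k : lo (G ord0 (x (N + k.+1)%N)) <=
    lo (G ord0 (x (N + k)%N)) + rho * (t (N + k)%N * P (N + k)%N).
  by rewrite addnS; have [] := decr (N + k)%N ord0.
have K_gt0 : 0 < 2 * L by rewrite mulr_gt0.
exact: (@cd_gradient_not_bounded_away R rho sigma eta (2 * L) (lo (B ord0)) gam
  (fun k => V (N + k)%N) (fun k => P (N + k)%N) (fun k => enorm (d (N + k)%N))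
  (fun k => t (N + k)%N) (fun k => lo (G ord0 (x (N + k)%N)))
  rho_gt0 sigma_gt0 sigma_lt1 eta_ge0 eta_lt K_gt0 gam_gt0 V_ge
  (fun k => enorm_ge0 _) (fun k => t_gt0 _) (fun k => descent _) D_rec
  (fun k => step _) f_dec (fun k => proj1 (HB _ ord0))).
Qed.
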